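(* A path graph is never a Nash equilibrium when nodes transact with each other according to the Zipf distribution with parameter $s\ge0$.
   Context: A payment channel network is an undirected graph on a set $V$ of players (each channel = two opposite directed edges). All channels cost $l>0$ to a player: the channel cost of a player $u$ is $l$ times the number of channels incident to $u$ (the cost of any edge is split equally between both parties). Zipf transaction distribution with parameter $s\ge 0$ (version averaged over ties): for a node $u$ in a graph on $V$, delete $u$ and its incident edges, obtaining a graph on $V'=V\setminus\{u\}$. Rank the nodes of $V'$ by (in-)degree (rank 1 = highest). For $v\in V'$ let $r_0(v)$ be the smallest rank of a node with the same degree as $v$, and $n(v)$ the number of nodes of $V'$ with that degree. Set $rf(v)=\frac{1}{n(v)}\sum_{j=r_0(v)}^{r_0(v)+n(v)-1}j^{-s}$ and $p^{trans}_{u,v}=rf(v)/\sum_{v'\in V'}rf(v')$, the probability that $u$ transacts with $v$. Expected revenue of $u$: $\mathbb{E}^{rev}_u=b\sum_{v_1\neq v_2,\ v_1,v_2\in V\setminus\{u\}}\frac{m_u(v_1,v_2)}{m(v_1,v_2)}p^{trans}_{v_1,v_2}$ (ordered pairs), where $m(v_1,v_2)$ is the number of shortest paths from $v_1$ to $v_2$, $m_u(v_1,v_2)$ the number of those passing through $u$ as an intermediary, and $b=N_{v_1}f_{avg}>0$ is assumed constant ($N_v$ = average number of transactions sent by $v$ per unit time, $f_{avg}$ = average fee). Expected fees of $u$: $\mathbb{E}^{fees}_u=a\sum_{v\neq u}d(u,v)\,p^{trans}_{u,v}$, where $a=N_uf^T_{avg}>0$ ($f^T_{avg}$ = average fee paid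 to each intermediary) and $d(u,v)$ is the shortest path length, $+\infty$ if disconnected. Utility of $u$: $\mathbb{E}^{rev}_u-\mathbb{E}^{fees}_u-(\text{channel cost of }u)$, which is $-\infty$ for a disconnected node. All quantities (including $p^{trans}$) are computed in the current graph. A unilateral deviation of $u$ replaces the set of channels incident to $u$ by any other set of channels incident to $u$ (adding and/or removing channels), all other channels being unchanged. A graph is a Nash equilibrium if no player can strictly increase its utility by a unilateral deviation.
   Formalization: The path graph is assumed to have at least 4 nodes; with 1 or 2 nodes it is always a Nash equilibrium, and with 3 nodes it is one whenever the channel cost l is at least a/2, so the unrestricted claim is false. *)

(* Defs.v *)
From mathcomp Require Import all_boot all_order all_algebra.
From mathcomp Require Import reals constructive_ereal exp.

Set Implicit Arguments.
Unset Strict Implicit.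
Unset Printing Implicit Defensive.

Import Order.TTheory GRing.Theory Num.Theory.
Local Open Scope ring_scope.

(* A channel graph on the players V is a symmetric irreflexive relation; one  *)
(* channel {x, y} is the pair of opposite edges (x, y), (y, x), so in-degree, *)
(* out-degree and number of incident channels coincide. Symmetry and          *)
(* irreflexivity are part of the adjacency condition in [path_graph] and are  *)
(* preserved by [deviate] when u \notin S.                                    *)

Definition path_graph (V : finType) (e : rel V) : Prop :=
  exists f : 'I_#|V| -> V,
    bijective f /\
    forall i j : 'I_#|V|, e (f i) (f j) = (i.+1 == j) || (j.+1 == i).

Section Graphs.
Context (V : finType).
Implicit Types (e : rel V) (u x y v w : V).

Definition deg e x : nat := #|[set y | e x y]|.

(* Deletion keeps the ambient type V: u becomes isolated, and the users of    *)
(* [del] below only consider the nodes v != u.                                *)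
Definition del e u : rel V := [rel x y | [&& x != u, y != u & e x y]].

(* A walk from x to y is represented by the list of its nodes after x, so its *)
(* size is its number of edges. Bounding this size by #|V| loses no shortest  *)
(* path.                                                                      *)
Definition walks e x y : {set #|V|.-bseq V} :=
  [set p : #|V|.-bseq V | path e x p && (last x p == y)].

Definition shortest_paths e x y : {set #|V|.-bseq V} :=
  [set p in walks e x y | [forall q in walks e x y, (size p <= size q)%N]].

Definition shortest_paths_via e u x y : {set #|V|.-bseq V} :=
  [set p in shortest_paths e x y | [&& u != x, u != y & u \in (p : seq V)]].

(* The minimum over the empty set is +oo, the distance of unconnected nodes.  *)
Definition dist (R : realType) e x y : \bar R :=
  \big[Order.min/+oo%E]_(p in walks e x y) ((size p)%:R%:E).

(* The graph after u has replaced its channels by channels to the nodes of S, *)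
(* where u \notin S.                                                         *)
Definition deviate e u (S : {set V}) : rel V :=
  [rel x y | if x == u then y \in S else if y == u then x \in S else e x y].

(* The nodes other than u by decreasing degree once u is deleted; the node at *)
(* position i has rank i + 1, and ties are broken arbitrarily. The first node *)
(* of a given degree has the smallest rank r0 whatever the tie-breaking.      *)
Definition ranking e u : seq V :=
  sort (fun v w => (deg (del e u) w <= deg (del e u) v)%N)
       (enum [set v | v != u]).

Definition r0 e u v : nat :=
  (find (fun w => deg (del e u) w == deg (del e u) v) (ranking e u)).+1.

Definition ntied e u v : nat :=
  #|[set w | (w != u) && (deg (del e u) w == deg (del e u) v)]|.

End Graphs.

Section Utility.
Context (R : realType) (V : finType).
Implicit Types (s a b l : R) (e : rel V) (u v : V).

Definition rf s e u v : R :=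
  (ntied e u v)%:R^-1 *
  \sum_(r0 e u v <= j < r0 e u v + ntied e u v) j%:R `^ (- s).

Definition ptrans s e u v : R :=
  rf s e u v / \sum_(v' | v' != u) rf s e u v'.

(* When v1 and v2 are not connected, the quotient is 0 / 0 = 0.               *)
Definition revenue s b e u : R :=
  b * \sum_(v1 | v1 != u) \sum_(v2 | (v2 != u) && (v1 != v2))
        #|shortest_paths_via e u v1 v2|%:R / #|shortest_paths e v1 v2|%:R
        * ptrans s e v1 v2.

Definition fees s a e u : \bar R :=
  (a%:E * \sum_(v | v != u) dist R e u v * (ptrans s e u v)%:E)%E.

Definition channel_cost l e u : R := l * (deg e u)%:R.

(* Every ptrans s e u v with v != u is positive, so for a > 0 the fees are    *)
(* +oo and the utility is -oo as soon as u cannot reach some node.            *)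
Definition utility s a b l e u : \bar R :=
  ((revenue s b e u)%:E - fees s a e u - (channel_cost l e u)%:E)%E.

Definition nash_equilibrium s a b l e : Prop :=
  ~ exists (u : V) (S : {set V}),
      u \notin S /\
      (utility s a b l e u < utility s a b l (deviate e u S) u)%E.

End Utility.

(* Main.v *)
Require Import Defs.
From mathcomp Require Import all_boot all_order all_algebra.
From mathcomp Require Import boolp reals constructive_ereal exp.
From mathcomp Require Import zify lra.

(** An end u of the path, with successive nodes u = v0, v1, v2, ..., gains by
    replacing its channel to v1 with a channel to v2. It remains a leaf, so it
    still pays for one channel and earns no revenue, and its transaction
    probabilities p are those of the graph without u, hence unchanged. Moving to
    v2 puts v1 one step further and every other node one step closer, so the
    fees drop by a (1 - 2 p(v1)). In the graph without u the other end of the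
    path has the same degree as v1, hence the same probability, and p(v2) > 0,
    so that p(v1) < 1/2. *)

Set Implicit Arguments.
Unset Strict Implicit.
Unset Printing Implicit Defensive.

Import Order.TTheory GRing.Theory Num.Theory.
Local Open Scope ring_scope.

Section Distances.
Context (R : realType) (V : finType).
Implicit Types (e : rel V) (u x y w : V) (p : seq V).

Lemma mem_walks e x y (p : #|V|.-bseq V) :
  (p \in walks e x y) = path e x p && (last x p == y).
Proof. by rewrite inE. Qed.

Lemma dist_le e x y p :
  path e x p -> last x p = y -> (size p <= #|V|)%N ->
  (dist R e x y <= (size p)%:R%:E)%E.
Proof.
move=> ep lp sp; apply: (bigmin_le_cond _ (j := Bseq sp)).
by rewrite mem_walks /= ep lp eqxx.
Qed.

Lemma dist_ge e x y d :
  (forall p, path e x p -> last x p = y -> (d <= size p)%N) ->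
  (d%:R%:E <= dist R e x y)%E.
Proof.
move=> le_d; apply: le_bigmin => [|p]; first exact: leey.
by rewrite mem_walks lee_fin ler_nat => /andP[ep /eqP lp]; apply: le_d.
Qed.

(** A walk passing through [u] enters it from [w] and must return to [w]; cutting out this detour
    leaves a walk with the same ends and two edges fewer. *)
Lemma shortest_paths_via_leaf e u w x y :
  (forall z, e u z -> z = w) -> (forall z, e z u -> z = w) ->
  shortest_paths_via e u x y = set0.
Proof.
move=> outu inu; apply/setP => p; rewrite in_set0; apply/negP.
rewrite inE inE mem_walks => /and3P[/andP[/andP[ep lp] /forall_inP minp] _].
case/andP=> uy; move: p ep lp minp => [p sp] /= ep lp minp up.
have [p1 [p2 pE]] : exists p1 p2, p = p1 ++ u :: p2.
  by case/splitPr: up => p1 p2; exists p1, p2.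
subst p; case: p2 => [|z p2] in ep lp sp minp up *.
  by move: lp uy; rewrite last_cat /= => ->.
move: ep lp; rewrite cat_path last_cat /= => /and4P[ep1 /inu lw /outu zw ep2] lp.
have sq : (size (p1 ++ p2) <= #|V|)%N.
  by move: sp; rewrite !size_cat /=; lia.
have := minp (Bseq sq); rewrite mem_walks /= cat_path last_cat lw -{1 2}zw ep1 ep2.
by rewrite lp !size_cat /= => /(_ isT); lia.
Qed.

End Distances.

Section Zipf.
Context (R : realType) (V : finType).
Implicit Types (s a b l : R) (e : rel V) (u v w : V).

Lemma rf_gt0 s e u v : v != u -> 0 < rf s e u v.
Proof.
move=> vu; have n0 : (0 < ntied e u v)%N.
  by apply/card_gt0P; exists v; rewrite inE vu eqxx.
rewrite /rf mulr_gt0 ?invr_gt0 ?ltr0n //.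
(* The range is nonempty and starts at [r0], a successor, so its first term is a power of a positive
   number. *)
rewrite big_ltn; last by lia.
rewrite ltr_pwDl ?powR_gt0 ?ltr0n //.
by apply: sumr_ge0 => j _; apply: powR_ge0.
Qed.

Lemma rf_ge0 s e u v : 0 <= rf s e u v.
Proof.
by rewrite mulr_ge0 ?invr_ge0 ?ler0n ?sumr_ge0 // => j _; apply: powR_ge0.
Qed.

Lemma ptrans_ge0 s e u v : 0 <= ptrans s e u v.
Proof. by rewrite divr_ge0 ?rf_ge0 ?sumr_ge0 // => w _; apply: rf_ge0. Qed.

Lemma ptrans_gt0 s e u v : v != u -> 0 < ptrans s e u v.
Proof.
move=> vu; rewrite divr_gt0 ?rf_gt0 // (bigD1 v) //= ltr_pwDl ?rf_gt0 //.
by apply: sumr_ge0 => w _; apply: rf_ge0.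
Qed.

(** Averaging over ties makes [rf] depend on a node only through its degree once [u] is deleted. *)
Lemma eq_deg_ptrans s e u v w :
  deg (del e u) v = deg (del e u) w -> ptrans s e u v = ptrans s e u w.
Proof. by move=> dvw; rewrite /ptrans /rf /r0 /ntied dvw. Qed.

(** A deviation only touches channels at [u], which the deletion discards. *)
Lemma del_deviate e u (S : {set V}) : del (deviate e u S) u = del e u.
Proof.
apply/funext => x; apply/funext => y; rewrite /del /deviate /=.
by case: (x =P u) => //= _; case: (y =P u).
Qed.

Lemma ptrans_deviate s e u (S : {set V}) v :
  ptrans s (deviate e u S) u v = ptrans s e u v.
Proof. by rewrite /ptrans /rf /r0 /ntied /ranking del_deviate. Qed.

Lemma revenue_ge0 s b e u : 0 <= b -> 0 <= revenue s b e u.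
Proof.
move=> b0; rewrite mulr_ge0 // sumr_ge0 // => x _; rewrite sumr_ge0 // => y _.
by apply: mulr_ge0; [apply: divr_ge0; apply: ler0n | apply: ptrans_ge0].
Qed.

Lemma revenue_leaf s b e u w :
  (forall z, e u z -> z = w) -> (forall z, e z u -> z = w) ->
  revenue s b e u = 0.
Proof.
move=> outu inu; rewrite /revenue big1 ?mulr0 // => x _; rewrite big1 // => y _.
by rewrite (shortest_paths_via_leaf _ _ outu inu) cards0 !mul0r.
Qed.

(** Together with [fees_ge], this moves the comparison of fees from extended reals to real sums:
    one-sided bounds on distances suffice, without computing them exactly. *)
Lemma fees_le s a e u (d : V -> R) : 0 <= a ->
  (forall v, v != u -> (dist R e u v <= (d v)%:E)%E) ->
  (fees s a e u <= (a * \sum_(v | v != u) d v * ptrans s e u v)%:E)%E.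
Proof.
move=> a0 led; rewrite EFinM -sumEFin lee_wpmul2l ?lee_fin //.
apply: lee_sum => v /led dv.
by rewrite (EFinM (d v)) lee_wpmul2r // lee_fin ptrans_ge0.
Qed.

Lemma fees_ge s a e u (d : V -> R) : 0 <= a ->
  (forall v, v != u -> ((d v)%:E <= dist R e u v)%E) ->
  ((a * \sum_(v | v != u) d v * ptrans s e u v)%:E <= fees s a e u)%E.
Proof.
move=> a0 led; rewrite EFinM -sumEFin lee_wpmul2l ?lee_fin //.
apply: lee_sum => v /led dv.
by rewrite (EFinM (d v)) lee_wpmul2r // lee_fin ptrans_ge0.
Qed.

Lemma utility_lt s a b l e e' u (f f' : R) :
  revenue s b e u <= revenue s b e' u ->
  channel_cost l e' u <= channel_cost l e u ->
  (f%:E <= fees s a e u)%E -> (fees s a e' u <= f'%:E)%E -> f' < f ->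
  (utility s a b l e u < utility s a b l e' u)%E.
Proof.
move=> rev cost fe fe' ff.
have le1 : (utility s a b l e u <=
    (revenue s b e u - f - channel_cost l e u)%:E)%E.
  by rewrite !EFinB; apply: leeB => //; apply: leeB.
have le2 : ((revenue s b e' u - f' - channel_cost l e' u)%:E <=
    utility s a b l e' u)%E.
  by rewrite !EFinB; apply: leeB => //; apply: leeB.
by apply: (le_lt_trans le1); apply: (lt_le_trans _ le2); rewrite lte_fin; lra.
Qed.

End Zipf.

Section Line.
Context (V : finType).
Implicit Types (e : rel V) (idx : V -> nat).

(** Positions along the path, taken in [nat] so that adjacency and equality of nodes become linear
    arithmetic. *)
Definition line_index e idx : Prop :=
  [/\ injective idx, forall x, (idx x < #|V|)%N,
      forall k, (k < #|V|)%N -> exists x, idx x = k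
    & forall x y, e x y = ((idx x).+1 == idx y) || ((idx y).+1 == idx x)].

Lemma path_graph_index e : path_graph e -> exists idx, line_index e idx.
Proof.
case=> f [[g fK gK] ef]; exists (fun x => val (g x)); split.
- by move=> x y /val_inj /(can_inj gK).
- by move=> x; apply: ltn_ord.
- by move=> k kn; exists (f (Ordinal kn)); rewrite fK.
- by move=> x y; rewrite -{1}(gK x) -{1}(gK y) ef.
Qed.

(** Each edge raises the position by at most one; from the end at position 0 this bounds distances
    below. *)
Lemma line_walk_index e idx x p : line_index e idx ->
  path e x p -> (idx (last x p) <= idx x + size p)%N.
Proof.
case=> _ _ _ eE; elim: p x => [|y p IHp] x /=; first by rewrite addn0.
by rewrite eE => /andP[exy /IHp]; lia.
Qed.

(** The walk jumps from [u] to position 2 and then follows the old path, never meeting [u] again. *)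
Lemma rewired_walk e idx u v2 m v : line_index e idx ->
  idx u = 0%N -> idx v2 = 2%N -> idx v = m.+2 ->
  exists p, [/\ path (deviate e u [set v2]) u p, last u p = v & size p = m.+1].
Proof.
move=> [inj_idx lt_idx sur_idx eE] u0 v22; elim: m v => [|m IHm] v vm.
  exists [:: v]; split => //=.
  rewrite /deviate /= eqxx andbT inE; apply/eqP/inj_idx.
  by rewrite vm.
have [|w wm] := sur_idx m.+2; first by have := lt_idx v; lia.
have [p [ep lp sp]] := IHm w wm.
exists (rcons p v); rewrite rcons_path last_rcons size_rcons sp ep lp; split=> //=.
have nu x : idx x != 0%N -> (x == u) = false.
  by move=> x0; apply/eqP => xu; rewrite xu u0 in x0.
by rewrite /deviate /= !nu ?wm ?vm // eE wm vm eqxx.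
Qed.

End Line.

Theorem theorem10 (R : realType) (V : finType) (e : rel V) (s a b l : R)
    (hs : 0 <= s) (ha : 0 < a) (hb : 0 < b) (hl : 0 < l)
    (hV : (4 <= #|V|)%N) (he : path_graph e) :
  ~ nash_equilibrium s a b l e.
Proof.
apply; have [idx lidx] := path_graph_index he.
have [inj_idx lt_idx sur_idx eE] := lidx.
have [|u u0] := sur_idx 0%N; first by lia.
have [|v1 i1] := sur_idx 1%N; first by lia.
have [|v2 i2] := sur_idx 2%N; first by lia.
(* [vl] is the other end of the path and [vk] its only neighbour. *)
have [|vl il] := sur_idx (#|V|.-1); first by lia.
have [|vk ik] := sur_idx (#|V|.-2); first by lia.
have idxE x y : (x == y) = (idx x == idx y) by rewrite (inj_eq inj_idx).
pose e' := deviate e u [set v2].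
have uv2 : u \notin [set v2] by rewrite inE idxE u0 i2.
exists u, [set v2]; split => //.
(* [d] will bound the old distances from [u] below, and [d'] the new ones above; [v1] is now reached
   through [v2]. *)
pose d v : R := (idx v)%:R.
pose d' v : R := if v == v1 then 2 else (idx v).-1%:R.
have deg_u : deg e u = 1%N.
  rewrite /deg (_ : [set y | e u y] = [set v1]) ?cards1 //.
  by apply/setP => y; rewrite !inE eE idxE u0 i1; lia.
have deg_u' : deg e' u = 1%N.
  rewrite /deg (_ : [set y | e' u y] = [set v2]) ?cards1 //.
  by apply/setP => y; rewrite inE /e' /deviate /= eqxx.
have p1l : ptrans s e u v1 = ptrans s e u vl.
  apply: eq_deg_ptrans; transitivity 1%N.
    rewrite /deg (_ : [set y | _ y] = [set v2]) ?cards1 //.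
    by apply/setP => y; rewrite !inE /del /= eE !idxE u0 i1 i2; lia.
  rewrite /deg (_ : [set y | _ y] = [set vk]) ?cards1 //.
  by apply/setP => y; rewrite !inE /del /= eE !idxE u0 il ik; have := lt_idx y; lia.
apply: (@utility_lt _ _ _ _ _ _ _ _ _
  (a * \sum_(v | v != u) d v * ptrans s e u v)
  (a * \sum_(v | v != u) d' v * ptrans s e' u v)).
(* The old revenue is zero, so nonnegativity of the new one is enough. *)
- rewrite (@revenue_leaf _ _ _ _ e _ v1) ?revenue_ge0 ?ltW //.
    by move=> z; rewrite eE => ez; apply: inj_idx; lia.
  by move=> z; rewrite eE => ez; apply: inj_idx; lia.
- by rewrite /channel_cost deg_u deg_u'.
- apply: fees_ge => [|v vu]; first exact: ltW.
  apply: dist_ge => p ep lp.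
  by have := line_walk_index lidx ep; rewrite lp u0.
- apply: fees_le => [|v vu]; first exact: ltW.
  rewrite /d'; case: (v =P v1) => [->|/eqP vv1].
    apply: (@dist_le _ _ _ _ _ [:: v2; v1]) => //; last by apply: leq_trans hV.
    rewrite /e' /deviate /= eqxx inE eqxx !idxE u0 i1 i2 /=.
    by rewrite eE i1 i2.
  move: vu vv1; rewrite !idxE u0 i1 => vu vv1.
  have vm : idx v = (idx v).-2.+2 by lia.
  have [p [ep lp sp]] := rewired_walk lidx u0 i2 vm.
  have -> : (idx v).-1 = size p by lia.
  by apply: dist_le => //; have := lt_idx v; lia.
rewrite ltr_pM2l //.
under eq_bigr do rewrite ptrans_deviate.
have ne x y : idx x != idx y -> x != y by rewrite idxE.
have n1u : v1 != u by apply: ne; lia.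
have n2u : v2 != u by apply: ne; lia.
have nlu : vl != u by apply: ne; lia.
have n21 : v2 != v1 by apply: ne; lia.
have nl1 : vl != v1 by apply: ne; lia.
(* This is where four nodes are needed: on three, [vl] would be [v2]. *)
have nl2 : vl != v2 by apply: ne; lia.
(* The loss at [v1] cancels against the gain at [vl], the gain at [v2] makes the inequality strict,
   and no other term increases. *)
rewrite !(bigD1 (P := fun v => v != u) v1) //=.
rewrite !(bigD1 (P := fun v => (v != u) && (v != v1)) v2) ?n2u //=.
rewrite !(bigD1 (P := fun v => (v != u) && (v != v1) && (v != v2)) vl) ?nlu ?nl1 //=.
set rest' := \sum_(_ | _) _; set rest := \sum_(_ | _) _.
have rest_le : rest' <= rest.
  apply: ler_sum => v /andP[/andP[/andP[_ nv1] _] _].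
  by rewrite ler_wpM2r ?ptrans_ge0 // /d' (negPf nv1) ler_nat leq_pred.
have dl : d vl = d' vl + 1.
  by rewrite /d /d' (negPf nl1) natr1 prednK // il; lia.
have p2 := ptrans_gt0 s e n2u.
rewrite dl /d /d' eqxx (negPf n21) i1 i2 /= p1l; lra.
Qed.
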